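(* Let $I$ be a monomial ideal of $R=K[x_1,\ldots,x_n]$ of height $\geq 2$. If $I=\bigcap_{j=1}^r\mathfrak q_j$ is the irreducible decomposition of $I$, then for each $\mathfrak q_j$ there is an irreducible component $\mathfrak q_j'$ of $\mathrm{sgn}(I)$ such that $\mathfrak q_j$ and $\mathfrak q_j'$ have the same radical and $\mathfrak q_j\subset\mathfrak q_j'$. Furthermore, $\mathrm{sgn}(I)=\bigcap_{j=1}^r\mathfrak q_j'$ is the irreducible decomposition of $\mathrm{sgn}(I)$, and it can be obtained by recursively applying the shift operation $I\mapsto I_{\rm sft}$ (starting with $I$ and ending at $\mathrm{sgn}(I)$) and making, at each shift step with respect to a variable $x_k$, the substitutions $x_k^{e}\mapsto x_k^{e-q_1+p+1}$, for all exponents $e\geq q_1$, in the minimal generators of the components of the irreducible decomposition of the current ideal, starting from the irreducible decomposition of $I$. Here $p$ and $q_1$ are the integers attached to that shift step.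
   Context: $K$ is a field and $R=K[x_1,\ldots,x_n]$. For $a\in\mathbb{N}^n$ (with $0\in\mathbb N$), $x^a:=x_1^{a_1}\cdots x_n^{a_n}$. A monomial ideal $I$ of $R$ has a unique finite minimal set of monomial generators $G(I)=\{x^{v_1},\ldots,x^{v_q}\}$. The incidence matrix of $I$ is the $n\times q$ matrix $A$ with columns $v_1,\ldots,v_q$. Signature: for each row $c=(c_1,\ldots,c_q)$ of $A$, list its distinct entries in ascending order $m_0<m_1<\cdots<m_r$, let $j_i$ be the index with $c_i=m_{j_i}$, and put $\mathrm{sgn}(c)=(j_1,\ldots,j_q)$. The matrix $\mathrm{sgn}(A)$ has rows $\mathrm{sgn}(c)$, with $c$ running over the rows of $A$. The signature $\mathrm{sgn}(I)$ is the ideal of $R$ generated by the monomials $x^w$ with $w$ a column of $\mathrm{sgn}(A)$. Irreducible decomposition: every monomial ideal has a unique irredundant decomposition as an intersection $\bigcap_{j=1}^r\mathfrak q_j$ of irreducible monomial ideals, i.e. ideals each generated by powers of some of the variables; the $\mathfrak q_j$ are its irreducible components. Shift operation: a row of an incidence matrix is tight if its set of distinct entries is $\{0,1,\ldots,\ell\}$ for some $\ell\ge 0$. Suppose every row of the incidence matrix of a monomial ideal $I$ has a zero entry (this holds when $\mathrm{ht}(I)\geq 2$) and the $k$-th row is not tight. Let $p\geq 0$ be the integer such that each of $0,1,\ldots,p$ occurs as the exponent of $x_k$ in some element of $G(I)$ and $p+1$ does not, and let $q_1$ be the smallest exponent of $x_k$ occurring in $G(I)$ that is larger than $p$; thus $q_1-p\geq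 2$. The shift $I_{\rm sft}$ of $I$ with respect to $x_k$ is the ideal of $R$ generated by the monomials of $G(I)$ whose $x_k$-exponent is at most $p$, together with the monomials $x_k^{e-q_1+p+1}u$ for all $x_k^{e}u\in G(I)$ with $e\geq q_1$ and $u$ not divisible by $x_k$. *)

(* Defs.v *)
From HB Require Import structures.
From mathcomp Require Import all_boot all_order all_algebra.
From mathcomp Require Import finmap mpoly.
From mathcomp Require Import boolp classical_sets.

Set Implicit Arguments.
Unset Strict Implicit.
Unset Printing Implicit Defensive.

Import GRing.Theory.
Local Open Scope classical_set_scope.
Local Open Scope ring_scope.

(* The unit ideal is allowed, unlike in [idealr_closed]. *)
Definition is_ideal (R : comNzRingType) (I : set R) : Prop :=
  I 0 /\ forall a u v : R, I u -> I v -> I (a * u + v).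

Definition ideal_gen (R : comNzRingType) (G : set R) : set R :=
  smallest (@is_ideal R) G.

Definition is_prime (R : comNzRingType) (P : set R) : Prop :=
  idealr_closed (mem P) /\ prime_idealr_closed (mem P).

Definition radical (R : comNzRingType) (I : set R) : set R :=
  [set f | exists2 k : nat, (0 < k)%N & I (f ^+ k)].

(* ht I >= h: the height of I is the infimum of the heights of the primes
   containing I, and the height of a prime P is the supremum of the lengths of
   the chains of primes C 0 < ... < C h = P.  The unit ideal has height +oo. *)
Definition height_ge (R : comNzRingType) (I : set R) (h : nat) : Prop :=
  forall P : set R, is_prime P -> I `<=` P ->
  exists C : nat -> set R,
    [/\ forall i, (i <= h)%N -> is_prime (C i),
        forall i, (i < h)%N -> C i `<` C i.+1
      & C h = P].

Definition monomial_gen (K : fieldType) (n : nat) (M : set 'X_{1..n}) :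
    set {mpoly K[n]} :=
  ideal_gen [set 'X_[v] | v in M].
Arguments monomial_gen K {n} M.

Definition is_monomial_ideal (K : fieldType) (n : nat)
    (I : set {mpoly K[n]}) : Prop :=
  exists M : set 'X_{1..n}, I = monomial_gen K M.

Definition is_mingens (K : fieldType) (n : nat) (I : set {mpoly K[n]})
    (G : {fset 'X_{1..n}}) : Prop :=
  I = monomial_gen K [set` G] /\
  forall G' : {fset 'X_{1..n}},
    (G' `<=` G)%fset -> I = monomial_gen K [set` G'] -> G' = G.

(* G(I), as a set of exponent vectors: the unique G with [is_mingens I G] when
   I is a monomial ideal, and the junk value fset0 otherwise. *)
Definition mingens (K : fieldType) (n : nat) (I : set {mpoly K[n]}) :
    {fset 'X_{1..n}} :=
  xget fset0 [set G | is_mingens I G].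

(* The columns are ordered as in the enumeration of the finite set G(I). *)
Definition incidence_mx (K : fieldType) (n : nat) (I : set {mpoly K[n]}) :
    'M[nat]_(n, #|` mingens I|) :=
  \matrix_(i < n, j < #|` mingens I|) nth 0%MM (mingens I) j i.

Definition row_values (q : nat) (c : 'rV[nat]_q) : seq nat :=
  sort leq (undup [seq c 0 j | j <- enum 'I_q]).

Definition sgn_row (q : nat) (c : 'rV[nat]_q) : 'rV[nat]_q :=
  \row_(j < q) index (c 0 j) (row_values c).

Definition sgn_mx (n q : nat) (A : 'M[nat]_(n, q)) : 'M[nat]_(n, q) :=
  \matrix_(i < n) sgn_row (row i A).

Definition mx_ideal_gen (K : fieldType) (n q : nat) (A : 'M[nat]_(n, q)) :
    set {mpoly K[n]} :=
  monomial_gen K (range (fun j : 'I_q => [multinom A i j | i < n])).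
Arguments mx_ideal_gen K {n q} A.

Definition signature (K : fieldType) (n : nat) (I : set {mpoly K[n]}) :
    set {mpoly K[n]} :=
  mx_ideal_gen K (sgn_mx (incidence_mx I)).

Definition is_irreducible (K : fieldType) (n : nat)
    (Q : set {mpoly K[n]}) : Prop :=
  exists (S : {set 'I_n}) (a : 'I_n -> nat),
    (forall i, i \in S -> (0 < a i)%N) /\
    Q = ideal_gen [set 'X_i ^+ a i | i in [set` S]].

Definition irr_decomp (K : fieldType) (n r : nat) (I : set {mpoly K[n]})
    (q : 'I_r -> set {mpoly K[n]}) : Prop :=
  [/\ forall j, is_irreducible (q j),
      I = \bigcap_(j in [set: 'I_r]) q j
    & forall j, \bigcap_(i in [set i | i != j]) q i <> I].

Definition irr_component (K : fieldType) (n : nat)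
    (I Q : set {mpoly K[n]}) : Prop :=
  exists (r : nat) (q : 'I_r -> set {mpoly K[n]}),
    irr_decomp I q /\ exists j, Q = q j.

Definition tight (q : nat) (c : 'rV[nat]_q) : Prop :=
  exists l : nat, row_values c =i iota 0 l.+1.

Definition shiftable (K : fieldType) (n : nat) (I : set {mpoly K[n]})
    (k : 'I_n) (p q1 : nat) : Prop :=
  let occurs e := exists2 v, v \in mingens I & v k = e in
  [/\ forall i, exists j, incidence_mx I i j = 0%N,
      ~ tight (row k (incidence_mx I)),
      (forall e, (e <= p)%N -> occurs e) /\ ~ occurs p.+1
    & [/\ occurs q1, (p < q1)%N
        & forall e, occurs e -> (p < e)%N -> (q1 <= e)%N]].

(* x_k^e u |-> x_k^(e - q1 + p + 1) u, meant for e >= q1 *)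
Definition shift_mon (n : nat) (k : 'I_n) (p q1 : nat) (v : 'X_{1..n}) :
    'X_{1..n} :=
  [multinom if i == k then (v k - q1 + p + 1)%N else v i | i < n].

Definition shift (K : fieldType) (n : nat) (I : set {mpoly K[n]})
    (k : 'I_n) (p q1 : nat) : set {mpoly K[n]} :=
  monomial_gen K
    ([set v | v \in mingens I /\ (v k <= p)%N] `|`
     [set shift_mon k p q1 v | v in [set v | v \in mingens I /\ (q1 <= v k)%N]]).

(* The substitution x_k^e |-> x_k^(e - q1 + p + 1), for e >= q1, in the minimal
   generators of a component Q; the other generators are kept. *)
Definition shift_component (K : fieldType) (n : nat) (Q : set {mpoly K[n]})
    (k : 'I_n) (p q1 : nat) : set {mpoly K[n]} :=
  monomial_gen K
    [set if (q1 <= v k)%N then shift_mon k p q1 v else v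
       | v in [set` mingens Q]].

(* [shift_steps I q J q']: finitely many shifts lead from I to J, every ideal
   on the way has the family carried along as irreducible decomposition, and
   the substitutions made at these shifts lead from q to q'. *)
Inductive shift_steps (K : fieldType) (n r : nat) :
    set {mpoly K[n]} -> ('I_r -> set {mpoly K[n]}) ->
    set {mpoly K[n]} -> ('I_r -> set {mpoly K[n]}) -> Prop :=
| shift_done I q : irr_decomp I q -> shift_steps I q I q
| shift_step I q (k : 'I_n) (p q1 : nat) J q' :
    irr_decomp I q ->
    shiftable I k p q1 ->
    shift_steps (shift I k p q1) (fun j => shift_component (q j) k p q1) J q' ->
    shift_steps I q J q'.

(* Main.v *)
Require Import Defs.
From mathcomp Require Import all_boot all_order all_algebra.
From mathcomp Require Import finmap mpoly.
From mathcomp Require Import boolp classical_sets.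
From mathcomp Require Import zify.

Set Implicit Arguments.
Unset Strict Implicit.
Unset Printing Implicit Defensive.

Import GRing.Theory.
Local Open Scope classical_set_scope.
Local Open Scope ring_scope.

(** A monomial ideal is determined by the up-closed set of its exponent
    vectors ([monomial_genE]), and an irreducible decomposition is a way to
    write this set irredundantly as an intersection of corners
    [{m | a i <= m i for some i in S}] ([irr_decompE]). Both a generator [v] and
    a corner are given by labels, one exponent per coordinate; moreover every
    label [a i] of an irredundant corner already occurs as the [i]-th exponent
    of some minimal generator ([corner_exponent_occurs]).

    Now replace, in each coordinate, the finitely many labels by others, in a
    strictly increasing way and keeping 0. A point [m] lies above a relabelled
    generator, or in a relabelled corner, exactly when [lower m] lies above the
    original one, where [lower] is the right adjoint of the relabelling. Hence
    the relabelled corners decompose the ideal of the relabelled generators, and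
    they remain irredundant because the relabelling is an order embedding of the
    grid of labels ([corner_decomp_relabel]). A shift is such a relabelling,
    and it acts on the components by the very substitution made in their
    generators; it lowers exponents but keeps them positive, so each component
    grows and keeps its radical ([irr_decomp_shift]).

    The signature is also a relabelling, by ranks. A shift preserves the order
    of the labels, hence the signature ([signature_relabel]); an ideal all of
    whose rows are tight is its own signature ([signature_tight]); and as long
    as some row is not tight a shift is possible and lowers the total degree of
    the generators. So the shifts end at the signature
    ([shift_to_signature]). The height enters only to give each row a zero
    entry: otherwise the ideal is contained in a prime [(x_k)], and below [(x_k)]
    there is no prime but 0 ([height2_zero_labels]). *)

(** * Ideals spanned by monomials *)

Definition up_closed (n : nat) (P : set 'X_{1..n}) : Prop :=
  forall m m', (m <= m')%MM -> P m -> P m'.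

Definition up (n : nat) (M : set 'X_{1..n}) : set 'X_{1..n} :=
  [set m | exists2 v, M v & (v <= m)%MM].

Definition mono_ideal (K : fieldType) (n : nat) (P : set 'X_{1..n}) :
    set {mpoly K[n]} :=
  [set f | forall m, m \in msupp f -> P m].
Arguments mono_ideal K {n} P.

Lemma up_up_closed n (M : set 'X_{1..n}) : up_closed (up M).
Proof. by move=> m m' le [v Mv vm]; exists v => //; exact: lepm_trans le. Qed.

Lemma mono_ideal_is_ideal (K : fieldType) n (P : set 'X_{1..n}) :
  up_closed P -> is_ideal (mono_ideal K P).
Proof.
move=> upP; split=> [m|a u v Iu Iv m /msuppD_le]; first by rewrite msupp0.
rewrite mem_cat => /orP[/msuppM_le/allpairsP[[m1 m2] /= [_ m2u ->]]|/Iv//].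
by apply: upP (Iu _ m2u); exact: lem_addl.
Qed.

Lemma mono_idealX (K : fieldType) n (P : set 'X_{1..n}) m :
  mono_ideal K P 'X_[m] <-> P m.
Proof.
split=> [|Pm m']; first by apply; rewrite msuppX inE.
by rewrite msuppX inE => /eqP->.
Qed.

Lemma mono_ideal_inj (K : fieldType) n (P Q : set 'X_{1..n}) :
  mono_ideal K P = mono_ideal K Q -> P = Q.
Proof.
by move=> PQ; apply/seteqP; split=> m /(mono_idealX K); 
  [rewrite PQ|rewrite -PQ] => /mono_idealX. Qed.

Lemma ideal_sum (R : comNzRingType) (J : set R) (T : eqType) (s : seq T)
    (F : T -> R) :
  is_ideal J -> {in s, forall i, J (F i)} -> J (\sum_(i <- s) F i).
Proof.
move=> [J0 JD] Js; rewrite big_seq; elim/big_ind: _ => //.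
by move=> x y Jx Jy; rewrite -[x]mul1r; exact: JD.
Qed.

Lemma ideal_mul (R : comNzRingType) (J : set R) (a u : R) :
  is_ideal J -> J u -> J (a * u).
Proof. by move=> [J0 JD] Ju; rewrite -[_ * _]addr0; exact: JD. Qed.

(** Multiplication by a polynomial only raises exponents, and sums create no
    new monomials. So a monomial ideal is the same thing as an up-closed set of
    exponent vectors, and ideal-theoretic questions become order-theoretic. *)
Lemma monomial_genE (K : fieldType) n (M : set 'X_{1..n}) :
  monomial_gen K M = mono_ideal K (up M).
Proof.
apply/seteqP; split=> f.
  apply: smallest_sub; first exact/mono_ideal_is_ideal/up_up_closed.
  by move=> _ [v Mv <-]; apply/mono_idealX; exists v => //; exact: lepm_refl.
move=> If J [idJ subJ]; rewrite [f]mpolyE; apply: ideal_sum => // m /If.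
case=> v Mv /submK <-; rewrite mpolyXD scalerAl.
by apply: ideal_mul => //; apply: subJ; exists v.
Qed.

Lemma mono_ideal_bigcap (K : fieldType) n (T : Type) (D : set T)
    (P : T -> set 'X_{1..n}) :
  \bigcap_(j in D) mono_ideal K (P j) = mono_ideal K (\bigcap_(j in D) P j).
Proof. by apply/seteqP; split=> f fP x Dx y Py; exact: (fP y Py x Dx). Qed.

(** * Minimal generators *)

Definition antichain (n : nat) (G : {fset 'X_{1..n}}) : Prop :=
  {in G &, forall u v, (u <= v)%MM -> u = v}.

(** Two generating sets of one monomial ideal have the same minimal elements,
    so an antichain is contained in every other generating set; this makes it
    the minimal generating set. *)
Lemma mingensE (K : fieldType) n (G : {fset 'X_{1..n}}) :
  antichain G -> mingens (monomial_gen K [set` G]) = G.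
Proof.
move=> antiG; have sub G' :
    monomial_gen K [set` G] = monomial_gen K [set` G'] -> (G `<=` G')%fset.
  rewrite !monomial_genE => /mono_ideal_inj GG'; apply/fsubsetP=> g gG.
  have [g' g'G' le] : up [set` G'] g.
    by rewrite -GG'; exists g => //; exact: lepm_refl.
  have [g'' g''G le'] : up [set` G] g'.
    by rewrite GG'; exists g' => //; exact: lepm_refl.
  have E := antiG _ _ g''G gG (lepm_trans le' le).
  suff -> : g = g' by [].
  apply/mnmP => i; apply/eqP; rewrite eqn_leq -{1}E.
  by apply/andP; split; exact: mnm_lepP.
have minG : is_mingens (monomial_gen K [set` G]) G.
  by split=> // G' G'G /sub GG'; apply/eqP; rewrite eqEfsubset G'G.
have [eqG minG'] := xgetPex fset0 (ex_intro _ _ minG).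
by symmetry; apply: minG' => //; exact: sub.
Qed.

(** A degree bound on the minimal elements makes them finite in number. *)
Lemma finite_antichain_gen n (P : set 'X_{1..n}) b :
  up_closed P ->
  (forall m, P m -> exists2 m', P m' & (m' <= m)%MM /\ (mdeg m' < b)%N) ->
  exists2 G : {fset 'X_{1..n}}, antichain G & P = up [set` G].
Proof.
move=> upP bndP.
pose minimal m := P m /\ forall m', P m' -> (m' <= m)%MM -> m' = m.
pose B : seq 'X_{1..n} := [seq bmnm m | m <- enum {: 'X_{1..n < b}}].
exists [fset m in B | `[< minimal m >]]%fset.
  move=> u v; rewrite !inE => /andP[_ /asboolP[Pu _]] /andP[_ /asboolP[_ minv]].
  exact: minv.
apply/seteqP; split=> m; last first.
  case=> v /=; rewrite !inE => /andP[_ /asboolP[Pv _]] vm; exact: upP Pv.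
have [d] := ubnP (mdeg m); elim: d m => // d IH m lt Pm.
have [minm|nmin] := pselect (minimal m).
  exists m; last exact: lepm_refl.
  rewrite /= !inE asboolT // andbT; have [m' Pm' [le ltb]] := bndP _ Pm.
  have E := minm.2 _ Pm' le; rewrite E in ltb.
  by apply/mapP; exists (BMultinom ltb); rewrite ?mem_enum.
have [m' [Pm' le ne]] : exists m', [/\ P m', (m' <= m)%MM & m' <> m].
  apply: contrapT => no; apply: nmin; split=> // m' Pm' le.
  by apply: contrapT => ne; apply: no; exists m'.
have ltd : (mdeg m' < mdeg m)%N.
  rewrite -(submK le) mdegD -[X in (X < _)%N]add0n ltn_add2r lt0n mdeg_eq0.
  by apply: contra_notN ne => /eqP z; rewrite -(submK le) z add0m.
have [g gG gm'] := IH m' (leq_trans ltd lt) Pm'.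
by exists g => //; exact: lepm_trans le.
Qed.

(** * Irreducible components *)

Definition corner (n : nat) (S : {set 'I_n}) (a : 'I_n -> nat) :
    set 'X_{1..n} :=
  [set m | exists2 i, i \in S & (a i <= m i)%N].

Lemma corner_up_closed n (S : {set 'I_n}) a : up_closed (corner S a).
Proof.
move=> m m' /mnm_lepP le [i iS am]; exists i => //; exact: leq_trans (le i).
Qed.

Lemma pow_mnm_le n (i : 'I_n) e (m : 'X_{1..n}) :
  (U_(i) *+ e <= m)%MM = (e <= m i)%N.
Proof.
apply/mnm_lepP/idP => [/(_ i)|le j]; rewrite mulmnE mnm1E ?eqxx ?mul1n //.
by case: eqP => [<-|_]; rewrite ?mul1n ?mul0n.
Qed.

Lemma cornerE n (S : {set 'I_n}) (a : 'I_n -> nat) :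
  corner S a = up [set (U_(i) *+ a i)%MM | i in [set` S]].
Proof.
apply/seteqP; split=> m.
  by case=> i iS le; exists (U_(i) *+ a i)%MM; [exists i|rewrite pow_mnm_le].
by case=> _ [i iS <-]; rewrite pow_mnm_le; exists i.
Qed.

Lemma irreducible_genE (K : fieldType) n (S : {set 'I_n}) (a : 'I_n -> nat) :
  ideal_gen [set ('X_i ^+ a i : {mpoly K[n]}) | i in [set` S]]
  = mono_ideal K (corner S a).
Proof.
rewrite cornerE -monomial_genE /monomial_gen; congr ideal_gen.
apply/seteqP; split=> f.
  by case=> i iS <-; exists (U_(i) *+ a i)%MM; rewrite ?mpolyXn //; exists i.
by case=> _ [i iS <-] <-; exists i => //; rewrite mpolyXn.
Qed.

Lemma mingens_corner (K : fieldType) n (S : {set 'I_n}) (a : 'I_n -> nat) :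
  (forall i, i \in S -> (0 < a i)%N) ->
  [set` mingens (mono_ideal K (corner S a))]
  = [set (U_(i) *+ a i)%MM | i in [set` S]].
Proof.
move=> apos; pose G := [fset (U_(i) *+ a i)%MM | i in enum S]%fset.
have GE : [set` G] = [set (U_(i) *+ a i)%MM | i in [set` S]].
  apply/seteqP; split=> m /=.
    by case/imfsetP => i /=; rewrite mem_enum => iS ->; exists i.
  by case=> i iS <-; apply/imfsetP; exists i; rewrite //= mem_enum.
rewrite cornerE -GE -monomial_genE mingensE // => u v.
case/imfsetP=> i /=; rewrite mem_enum => iS -> /imfsetP[j /= _ ->].
rewrite pow_mnm_le mulmnE mnm1E; case: eqP => [->//|_].
by rewrite mul0n leqNgt apos.
Qed.

(** Irredundance is given by witnesses, since what is done to a decomposition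
    is done to points. *)
Definition corner_decomp (n r : nat) (P : set 'X_{1..n})
    (S : 'I_r -> {set 'I_n}) (a : 'I_r -> 'I_n -> nat) : Prop :=
  (forall m, P m <-> forall j, corner (S j) (a j) m) /\
  forall j, exists2 m, ~ corner (S j) (a j) m &
    forall i, i != j -> corner (S i) (a i) m.

Lemma irr_decompE (K : fieldType) n r (P : set 'X_{1..n})
    (S : 'I_r -> {set 'I_n}) (a : 'I_r -> 'I_n -> nat) :
  (forall j i, i \in S j -> (0 < a j i)%N) ->
  irr_decomp (mono_ideal K P) (fun j => mono_ideal K (corner (S j) (a j)))
  <-> corner_decomp P S a.
Proof.
move=> apos; split=> [[_]|[PE irr]].
  rewrite mono_ideal_bigcap => /mono_ideal_inj PE irr; split=> [m|j].
    by rewrite PE; split=> [Pm j|Pm j _]; exact: Pm.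
  apply: contrapT => no; apply: (irr j); rewrite mono_ideal_bigcap PE.
  congr mono_ideal; apply/seteqP; split=> m mP i _; last exact: mP.
  have [->|ne] := eqVneq i j; last exact: mP.
  by apply: contrapT => nj; apply: no; exists m.
split=> [j||j].
- by exists (S j), (a j); split; [exact: apos|rewrite irreducible_genE].
- rewrite mono_ideal_bigcap; congr mono_ideal; apply/seteqP; split=> m.
    by move=> /PE Pm j _; exact: Pm.
  by move=> Pm; apply/PE => j; exact: Pm.
rewrite mono_ideal_bigcap => /mono_ideal_inj E; have [m nm mP] := irr j.
have /PE Pm : P m by rewrite -E => i ne; exact: mP.
exact: nm (Pm j).
Qed.

Lemma irr_decomp_corner (K : fieldType) n r (I : set {mpoly K[n]})
    (q : 'I_r -> set {mpoly K[n]}) :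
  irr_decomp I q ->
  exists (P : set 'X_{1..n}) (S : 'I_r -> {set 'I_n}) (a : 'I_r -> 'I_n -> nat),
    [/\ forall j i, i \in S j -> (0 < a j i)%N, I = mono_ideal K P,
        q = (fun j => mono_ideal K (corner (S j) (a j)))
      & corner_decomp P S a].
Proof.
move=> dec; have [irr IE _] := dec.
have [S /choice[a Sa]] := choice irr.
have apos j := (Sa j).1.
have qE : q = (fun j => mono_ideal K (corner (S j) (a j))).
  by apply/funext => j; rewrite (Sa j).2 irreducible_genE.
rewrite qE mono_ideal_bigcap in IE.
exists (\bigcap_(j in [set: 'I_r]) corner (S j) (a j)), S, a; split=> //.
by apply/(irr_decompE K) => //; rewrite -IE -qE.
Qed.

(** Truncating the exponents at a common bound of the [a j i] does not change
    membership in the corners, so minimal elements lie in a box. *)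
Lemma corner_decomp_gen n r (P : set 'X_{1..n})
    (S : 'I_r -> {set 'I_n}) (a : 'I_r -> 'I_n -> nat) :
  corner_decomp P S a ->
  exists2 G : {fset 'X_{1..n}}, antichain G & P = up [set` G].
Proof.
move=> [PE _]; pose B := (\sum_j \sum_i a j i)%N.
have aB j i : (a j i <= B)%N.
  by rewrite /B (bigD1 j) //= (bigD1 i) //= -addnA leq_addr.
apply: (@finite_antichain_gen _ _ (n * B).+1) => [m m' le /PE Pm|m /PE Pm].
  by apply/PE => j; exact: corner_up_closed le (Pm j).
exists [multinom minn (m i) B | i < n].
  apply/PE => j; have [i iS am] := Pm j.
  by exists i => //; rewrite mnmE leq_min am aB.
split; first by apply/mnm_lepP => i; rewrite mnmE geq_minl.
rewrite ltnS mdegE -[n in (n * _)%N]card_ord -sum_nat_const.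
by apply: leq_sum => i _; rewrite mnmE geq_minr.
Qed.

(** Raise a point that only the [j]-th corner misses until it touches that
    corner from outside; one more step in direction [i] enters the
    intersection, so a generator has exactly the exponent [a j i] there. *)
Lemma corner_exponent_occurs n r (G : set 'X_{1..n})
    (S : 'I_r -> {set 'I_n}) (a : 'I_r -> 'I_n -> nat) :
  (forall j i, i \in S j -> (0 < a j i)%N) ->
  corner_decomp (up G) S a ->
  forall j i, i \in S j -> exists2 v, G v & v i = a j i.
Proof.
move=> apos [GE irr] j i iS; have [m nm mP] := irr j.
have ltm k : k \in S j -> (m k < a j k)%N.
  by move=> kS; rewrite ltnNge; apply/negP => le; apply: nm; exists k.
(* [t] is the largest point below the [j]-th corner on the coordinates of
   [S j], still above [m], hence in all the other corners. *)
pose t := [multinom if k \in S j then (a j k).-1 else m k | k < n].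
have mt : (m <= t)%MM.
  apply/mnm_lepP => k; rewrite mnmE; case: ifP => // kS.
  by rewrite -ltnS prednK ?apos ?ltm.
have nt : ~ up G t.
  move=> /GE/(_ j)[k kS]; rewrite mnmE kS.
  by rewrite -ltnS prednK ?apos // ltnn.
have [v Gv le] : up G (t + U_(i))%MM.
  apply/GE => l; have [->|ne] := eqVneq l j.
    by exists i => //; rewrite mnmDE mnm1E eqxx mnmE iS addn1 prednK ?apos.
  apply: corner_up_closed (mP l ne).
  exact: lepm_trans mt (lem_addr _ _).
exists v => //; apply: contrapT => ne; apply: nt; exists v => //.
apply/mnm_lepP => k; have := mnm_lepP le k; rewrite mnmDE mnm1E.
have [<-|_] := eqVneq i k; last by rewrite addn0.
move: ne; rewrite mnmE iS addn1 prednK ?apos // => ne le'.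
by rewrite -ltnS prednK ?apos // ltn_neqAle le' andbT; apply/eqP.
Qed.

(** * Relabelling the exponents *)

Definition relabel (n : nat) (s : 'I_n -> nat -> nat) (m : 'X_{1..n}) :
    'X_{1..n} :=
  [multinom s i (m i) | i < n].

(** Monotonicity is asked on the labels in [D] only: a shift may fail to be
    monotone on exponents that do not occur. *)
Definition relabelling (n : nat) (D : 'I_n -> seq nat)
    (s : 'I_n -> nat -> nat) : Prop :=
  forall i, [/\ 0%N \in D i, s i 0%N = 0%N &
    {in D i &, {mono s i : d e / (d <= e)%N}}].

(** The right adjoint of [relabel s] on the grid of labels [D]. *)
Definition lower (n : nat) (D : 'I_n -> seq nat) (s : 'I_n -> nat -> nat)
    (m : 'X_{1..n}) : 'X_{1..n} :=
  [multinom (\max_(d <- D i | s i d <= m i) d)%N | i < n].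

Lemma relabelling_id n (D : 'I_n -> seq nat) :
  (forall i, 0%N \in D i) -> relabelling D (fun=> id).
Proof. by move=> D0 i; split. Qed.

Lemma lower_in n D s (m : 'X_{1..n}) i :
  relabelling D s -> lower D s m i \in D i /\ (s i (lower D s m i) <= m i)%N.
Proof.
move=> /(_ i)[D0 s0 _]; rewrite mnmE big_seq_cond.
elim/big_ind: _ => [|x y [xD xm] [yD ym]|d /andP[]] //; first by rewrite s0.
by rewrite /maxn; case: ifP.
Qed.

Lemma lowerP n D s (m : 'X_{1..n}) i d :
  relabelling D s -> d \in D i -> (s i d <= m i)%N = (d <= lower D s m i)%N.
Proof.
move=> Ds dD; apply/idP/idP => [le|].
  by rewrite mnmE; apply: (@leq_bigmax_seq _ _ (fun e => s i e <= m i)%N id).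
have [lD le] := lower_in m i Ds; have [_ _ smono] := Ds i.
by rewrite -smono // => le'; exact: leq_trans le.
Qed.

Lemma lower_relabel n D s (m : 'X_{1..n}) :
  relabelling D s -> (forall i, m i \in D i) -> lower D s (relabel s m) = m.
Proof.
move=> Ds mD; apply/mnmP => i; apply/eqP; rewrite eqn_leq.
rewrite -(lowerP _ Ds) // [relabel s m i]mnmE leqnn andbT.
have [lD le] := lower_in (relabel s m) i Ds; have [_ _ smono] := Ds i.
by rewrite [relabel s m i]mnmE smono in le.
Qed.

Lemma relabel_le_lower n D s (u m : 'X_{1..n}) :
  relabelling D s -> (forall i, u i \in D i) ->
  (relabel s u <= m)%MM = (u <= lower D s m)%MM.
Proof.
move=> Ds uD; apply/mnm_lepP/mnm_lepP => le i; have := le i.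
  by rewrite [relabel s u i]mnmE (lowerP _ Ds).
by rewrite [relabel s u i]mnmE (lowerP _ Ds).
Qed.

Lemma relabel_corner n D s (S : {set 'I_n}) (a : 'I_n -> nat) m :
  relabelling D s -> (forall i, i \in S -> a i \in D i) ->
  corner S (fun i => s i (a i)) m <-> corner S a (lower D s m).
Proof.
by move=> Ds aD; split=> -[i iS le]; exists i => //; move: le;
  rewrite (lowerP _ Ds) ?aD.
Qed.

(** By the adjunction, both sides of the decomposition are pulled back along
    [lower]. A point witnessing irredundance is first rounded down to the grid
    of labels, where [relabel s] is an order embedding. *)
Lemma corner_decomp_relabel n r D s (G : set 'X_{1..n})
    (S : 'I_r -> {set 'I_n}) (a : 'I_r -> 'I_n -> nat) :
  relabelling D s ->
  (forall v, G v -> forall i, v i \in D i) ->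
  (forall j i, i \in S j -> a j i \in D i) ->
  corner_decomp (up G) S a ->
  corner_decomp (up (relabel s @` G)) S (fun j i => s i (a j i)).
Proof.
move=> Ds GD aD [GE irr]; split=> [m|j].
  have -> : up (relabel s @` G) m <-> up G (lower D s m).
    split=> [[_ [v Gv <-]]|[v Gv le]].
      by rewrite (relabel_le_lower _ Ds) => [le|]; [exists v|exact: GD].
    exists (relabel s v); first by exists v.
    by rewrite (relabel_le_lower _ Ds) //; exact: GD.
  by rewrite GE; split=> cP j; apply/(relabel_corner _ Ds) => //; exact: aD.
have Did : relabelling D (fun=> id) by apply: relabelling_id => i; case: (Ds i).
have [m nm mP] := irr j; pose t := lower D (fun=> id) m.
have tE l : corner (S l) (fun i => s i (a l i)) (relabel s t)
    <-> corner (S l) (a l) m.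
  rewrite (relabel_corner _ Ds) ?lower_relabel //; last exact: aD.
    by rewrite -(relabel_corner _ Did) //; exact: aD.
  by move=> i; have [] := lower_in m i Did.
by exists (relabel s t) => [/tE//|i ne]; apply/tE/mP.
Qed.

Lemma relabel_mono n D s (u v : 'X_{1..n}) :
  relabelling D s -> (forall i, u i \in D i) -> (forall i, v i \in D i) ->
  (relabel s u <= relabel s v)%MM = (u <= v)%MM.
Proof.
by move=> Ds uD vD; rewrite (relabel_le_lower _ Ds) // lower_relabel.
Qed.

Lemma imfset_relabel n s (G : {fset 'X_{1..n}}) :
  [set` [fset relabel s v | v in G]%fset] = relabel s @` [set` G].
Proof.
apply/seteqP; split=> m /=; first by case/imfsetP => v /= vG ->; exists v.
by case=> v vG <-; apply/imfsetP; exists v.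
Qed.

Definition labels (n : nat) (G : {fset 'X_{1..n}}) (i : 'I_n) : seq nat :=
  [seq (v : 'X_{1..n}) i | v <- G].

Lemma labels_in n (G : {fset 'X_{1..n}}) v i : v \in G -> v i \in labels G i.
Proof. by move=> vG; apply/mapP; exists v. Qed.

Lemma labels_relabel n s (G : {fset 'X_{1..n}}) i :
  labels [fset relabel s v | v in G]%fset i =i [seq s i e | e <- labels G i].
Proof.
move=> e; apply/mapP/mapP.
  case=> _ /imfsetP[v /= vG ->] ->; exists (v i); first exact: labels_in.
  by rewrite mnmE.
case=> _ /mapP[v vG ->] ->; exists (relabel s v); last by rewrite mnmE.
by apply/imfsetP; exists v.
Qed.

Lemma antichain_relabel n s (G : {fset 'X_{1..n}}) :
  relabelling (labels G) s -> antichain G ->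
  antichain [fset relabel s v | v in G]%fset.
Proof.
move=> Gs antiG _ _ /imfsetP[u /= uG ->] /imfsetP[v /= vG ->].
rewrite (relabel_mono Gs) => [/antiG->//|i|i]; exact: labels_in.
Qed.

Lemma zero_labels_relabel n s (G : {fset 'X_{1..n}}) :
  relabelling (labels G) s ->
  forall i, 0%N \in labels [fset relabel s v | v in G]%fset i.
Proof.
move=> Gs i; have [G0 s0 _] := Gs i; rewrite labels_relabel.
by apply/mapP; exists 0%N.
Qed.

(** * The signature as a relabelling *)

(** The entry that the signature puts in place of [e] in a row [s]. *)
Definition rank (s : seq nat) (e : nat) : nat := index e (sort leq (undup s)).

Lemma row_values_sorted s : sorted ltn (sort leq (undup s)).
Proof.
by rewrite ltn_sorted_uniq_leq sort_uniq undup_uniq sort_sorted.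
Qed.

(** An order embedding carries the increasing list of the values of [s] to that
    of [t], position by position. *)
Lemma rank_map (f : nat -> nat) (s t : seq nat) :
  t =i [seq f e | e <- s] -> {in s &, {mono f : d e / (d <= e)%N}} ->
  {in s, forall e, rank t (f e) = rank s e}.
Proof.
move=> ts fmono e es; rewrite /rank; set u := sort leq (undup s).
have us : u =i s by move=> x; rewrite mem_sort mem_undup.
have -> : sort leq (undup t) = map f u.
  apply: (irr_sorted_eq ltn_trans ltnn); first exact: row_values_sorted.
    rewrite sorted_map.
    apply: (@sub_in_sorted _ (mem s) ltn); last exact: row_values_sorted.
      by move=> x y xs ys /= lt; rewrite ltnNge fmono // -ltnNge.
    by apply/allP => x; rewrite us.
  by move=> x; rewrite mem_sort mem_undup ts (eq_mem_map f us).
have eu : e \in u by rewrite us.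
have funiq : uniq (map f u).
  rewrite map_inj_in_uniq ?sort_uniq ?undup_uniq // => x y.
  rewrite !us => xs ys E.
  by apply/eqP; rewrite eqn_leq -(fmono x y) // -(fmono y x) // E leqnn.
rewrite -{1}(nth_index 0%N eu) -(nth_map _ 0%N) ?index_mem //.
by rewrite index_uniq // size_map index_mem.
Qed.

Lemma rank_iota s l e : sort leq (undup s) =i iota 0 l.+1 -> e \in s ->
  rank s e = e.
Proof.
move=> sE es; have -> : rank s e = index e (iota 0 l.+1).
  congr index; apply: (irr_sorted_eq ltn_trans ltnn) => //.
    exact: row_values_sorted.
  exact: iota_ltn_sorted.
have : e \in iota 0 l.+1 by rewrite -sE mem_sort mem_undup.
rewrite mem_iota add0n => /= lt.
have := @index_uniq _ 0%N e (iota 0 l.+1).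
by rewrite nth_iota // size_iota; apply=> //; exact: iota_uniq.
Qed.

Lemma row_values_incidence (K : fieldType) n (I : set {mpoly K[n]}) i :
  row_values (row i (incidence_mx I)) = sort leq (undup (labels (mingens I) i)).
Proof.
rewrite /row_values /labels; congr (sort leq (undup _)).
rewrite -[X in _ = map _ X](mkseq_nth 0%MM) /mkseq -map_comp.
rewrite -val_enum_ord -map_comp.
by apply: eq_map => j; rewrite !mxE.
Qed.

Lemma signatureE (K : fieldType) n (G : {fset 'X_{1..n}}) :
  antichain G ->
  signature (monomial_gen K [set` G])
  = monomial_gen K (relabel (fun i => rank (labels G i)) @` [set` G]).
Proof.
move=> antiG; rewrite /signature /mx_ideal_gen.
set I := monomial_gen K [set` G].
have GE : mingens I = G by rewrite /I mingensE.
have col (j : 'I_#|` mingens I|) :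
    [multinom sgn_mx (incidence_mx I) i j | i < n]
    = relabel (fun i => rank (labels G i)) (nth 0%MM (mingens I) j).
  by apply/mnmP => i; rewrite !mnmE !mxE row_values_incidence -GE.
congr monomial_gen; apply/seteqP; split=> m /=.
  case=> j _ <-; rewrite col; exists (nth 0%MM (mingens I) j) => //=.
  by rewrite -[in X in _ \in X]GE mem_nth.
case=> v /=; rewrite -[in X in _ \in X]GE => vG <-.
have lt : (index v (mingens I) < #|` mingens I|)%N by rewrite index_mem.
by exists (Ordinal lt) => //; rewrite col nth_index.
Qed.

Lemma signature_relabel (K : fieldType) n s (G : {fset 'X_{1..n}}) :
  relabelling (labels G) s -> antichain G ->
  signature (monomial_gen K (relabel s @` [set` G]))
  = signature (monomial_gen K [set` G]).
Proof.
move=> Gs antiG; rewrite -imfset_relabel !signatureE ?imfset_relabel //.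
  2: exact: antichain_relabel.
congr monomial_gen; rewrite image_comp; apply: eq_imagel => v vG.
apply/mnmP => i; rewrite !mnmE (@rank_map (s i) (labels G i)) ?labels_in //.
  exact: labels_relabel.
by case: (Gs i).
Qed.

(** * One shift *)

Definition shift_label (n : nat) (k : 'I_n) (p q1 : nat) (i : 'I_n) (e : nat) :
    nat :=
  if (i == k) && (q1 <= e)%N then (e - q1 + p + 1)%N else e.

Lemma relabel_shift n (k : 'I_n) p q1 (v : 'X_{1..n}) :
  relabel (shift_label k p q1) v
  = if (q1 <= v k)%N then shift_mon k p q1 v else v.
Proof.
apply/mnmP => i; rewrite mnmE /shift_label.
have [->|ne] /= := eqVneq i k; case: (leqP q1 (v k)) => //= _.
  by rewrite mnmE eqxx.
by rewrite mnmE (negbTE ne).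
Qed.

Lemma relabelling_shift n (D : 'I_n -> seq nat) (k : 'I_n) p q1 :
  (forall i, 0%N \in D i) -> (p < q1)%N ->
  {in D k, forall e, (p < e)%N -> (q1 <= e)%N} ->
  relabelling D (shift_label k p q1).
Proof.
move=> D0 pq gap i; split=> [//||d e dD eD].
  by rewrite /shift_label leqn0 (gtn_eqF (leq_ltn_trans (leq0n p) pq)) andbF.
rewrite /shift_label; case: eqP dD eD => [->|] //= dD eD.
have := gap d dD; have := gap e eD.
by case: (leqP q1 d); case: (leqP q1 e); lia.
Qed.

Lemma shift_label_le n (k : 'I_n) p q1 i e :
  (p < q1)%N -> (shift_label k p q1 i e <= e)%N.
Proof. by move=> pq; rewrite /shift_label; case: ifP => // /andP[_]; lia. Qed.

Lemma shift_label_gt0 n (k : 'I_n) p q1 i e :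
  (0 < e)%N -> (0 < shift_label k p q1 i e)%N.
Proof. by rewrite /shift_label; case: ifP => // _; lia. Qed.

Lemma shiftE (K : fieldType) n (G : {fset 'X_{1..n}}) (k : 'I_n) p q1 :
  antichain G -> (p < q1)%N ->
  {in labels G k, forall e, (p < e)%N -> (q1 <= e)%N} ->
  shift (monomial_gen K [set` G]) k p q1
  = monomial_gen K (relabel (shift_label k p q1) @` [set` G]).
Proof.
move=> antiG pq gap; rewrite /shift mingensE //; congr monomial_gen.
apply/seteqP; split=> m.
  case=> [[mG mp]|[v [vG vq] <-]].
    by exists m => //; rewrite relabel_shift leqNgt (leq_ltn_trans mp pq).
  by exists v => //; rewrite relabel_shift vq.
case=> v vG <-; rewrite relabel_shift; case: ifP => [vq|nq].
  by right; exists v.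
left; split=> //; rewrite leqNgt; apply/negP => /gap.
by rewrite nq; move=> /(_ (labels_in _ vG)).
Qed.

Lemma shift_component_corner (K : fieldType) n (S : {set 'I_n})
    (a : 'I_n -> nat) (k : 'I_n) p q1 :
  (forall i, i \in S -> (0 < a i)%N) -> (0 < q1)%N ->
  shift_component (mono_ideal K (corner S a)) k p q1
  = mono_ideal K (corner S (fun i => shift_label k p q1 i (a i))).
Proof.
move=> apos q0; rewrite /shift_component mingens_corner //.
rewrite cornerE -monomial_genE; congr monomial_gen.
have relabel_pow i : relabel (shift_label k p q1) (U_(i) *+ a i)%MM
    = (U_(i) *+ shift_label k p q1 i (a i))%MM.
  apply/mnmP => j; rewrite mnmE !mulmnE mnm1E.
  have [->|_] := eqVneq i j; rewrite ?mul1n // !mul0n /shift_label.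
  by rewrite leqNgt q0 andbF.
rewrite image_comp; apply: eq_imagel => i _ /=.
by rewrite -relabel_shift relabel_pow.
Qed.

(** Every monomial of [f ^+ N] is a product of [N] monomials of [f], each
    divisible by a variable of [S], so for [N] large some variable of [S]
    is repeated often enough. *)
Lemma corner_radical_sub (K : fieldType) n (S : {set 'I_n})
    (a b : 'I_n -> nat) :
  (forall i, i \in S -> (0 < b i)%N) ->
  mono_ideal K (corner S b) `<=` radical (mono_ideal K (corner S a)).
Proof.
move=> bpos f fb; pose N := (\sum_(i in S) a i)%N.
have pow d m : m \in msupp (f ^+ d) -> (d <= \sum_(i in S) m i)%N.
  elim: d m => [//|d IH] m; rewrite exprS => /msuppM_le/allpairsP[[u v] /=].
  case=> /fb[i iS ui] /IH lev ->.
  under eq_bigr do rewrite mnmDE.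
  rewrite big_split /= -add1n leq_add // (bigD1 i) //=.
  by rewrite ltn_addr // (leq_trans (bpos i iS) ui).
exists N.+1 => // m /pow; rewrite leqNgt => lt; apply: contrapT => nm.
move/negP: lt; apply; rewrite ltnS leq_sum // => i iS.
by rewrite leqNgt; apply/negP => lt; apply: nm; exists i => //; exact: ltnW.
Qed.

(** Both ideals have the radical generated by the variables of [S]. *)
Lemma corner_radical (K : fieldType) n (S : {set 'I_n}) (a b : 'I_n -> nat) :
  (forall i, i \in S -> (0 < a i)%N) -> (forall i, i \in S -> (0 < b i)%N) ->
  radical (mono_ideal K (corner S a)) = radical (mono_ideal K (corner S b)).
Proof.
have sub a' b' : (forall i, i \in S -> (0 < a' i)%N) ->
    radical (mono_ideal K (corner S a')) `<=` radical (mono_ideal K (corner S b')).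
  move=> a0 f [d d0 /(corner_radical_sub b' a0)[N N0]].
  by rewrite -exprM; exists (d * N)%N; rewrite ?muln_gt0 ?d0.
by move=> a0 b0; apply/seteqP; split; exact: sub.
Qed.

Lemma corner_subset (K : fieldType) n (S : {set 'I_n}) (a b : 'I_n -> nat) :
  (forall i, (b i <= a i)%N) ->
  mono_ideal K (corner S a) `<=` mono_ideal K (corner S b).
Proof.
move=> ba f fa m /fa[i iS am]; exists i => //; exact: leq_trans am.
Qed.

(** Minimal generators of a component are pure powers whose exponents occur in
    the ideal, so the substitution in a component is the same relabelling that
    turns the ideal into its shift. *)
Lemma irr_decomp_shift (K : fieldType) n r (G : {fset 'X_{1..n}})
    (q : 'I_r -> set {mpoly K[n]}) (k : 'I_n) p q1 :
  (forall i, 0%N \in labels G i) -> (p < q1)%N ->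
  {in labels G k, forall e, (p < e)%N -> (q1 <= e)%N} ->
  irr_decomp (monomial_gen K [set` G]) q ->
  irr_decomp (monomial_gen K (relabel (shift_label k p q1) @` [set` G]))
    (fun j => shift_component (q j) k p q1) /\
  forall j, radical (q j) = radical (shift_component (q j) k p q1) /\
    q j `<=` shift_component (q j) k p q1.
Proof.
move=> G0 pq gap /irr_decomp_corner[P [S [a [apos IE -> dec]]]].
move: IE; rewrite monomial_genE => /mono_ideal_inj PE; rewrite -{P}PE in dec.
have q0 : (0 < q1)%N := leq_ltn_trans (leq0n p) pq.
have scE j := shift_component_corner K k p (apos j) q0.
have spos j i : i \in S j -> (0 < shift_label k p q1 i (a j i))%N.
  by move=> iS; rewrite shift_label_gt0 ?apos.
split=> [|j].
  rewrite (funext scE) monomial_genE; apply/irr_decompE => //.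
  apply: (@corner_decomp_relabel _ _ (labels G)) (dec).
  - exact: relabelling_shift.
  - by move=> v vG i; exact: labels_in.
  move=> j i iS; have [v vG <-] := corner_exponent_occurs apos dec iS.
  exact: labels_in.
rewrite scE; split; first by apply: corner_radical; [exact: apos|exact: spos].
by apply: corner_subset => i; exact: shift_label_le.
Qed.

(** * Shifting down to the signature *)

Lemma incidence_zero (K : fieldType) n (I : set {mpoly K[n]}) i :
  0%N \in labels (mingens I) i -> exists j, incidence_mx I i j = 0%N.
Proof.
case/mapP => v vG v0; have lt : (index v (mingens I) < #|` mingens I|)%N.
  by rewrite index_mem.
by exists (Ordinal lt); rewrite mxE nth_index.
Qed.

(** [p.+1] is the first missing value and [q1] the first value beyond it; the
    latter exists since otherwise [s] would be the interval up to [p]. *)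
Lemma gap_of_not_interval (s : seq nat) :
  0%N \in s -> ~ (exists l, s =i iota 0 l.+1) ->
  exists p q1, [/\ forall e, (e <= p)%N -> e \in s, p.+1 \notin s, q1 \in s,
    (p.+1 < q1)%N & {in s, forall e, (p < e)%N -> (q1 <= e)%N}].
Proof.
move=> s0 ni.
have big : exists e, e \notin s.
  exists (\max_(e <- s) e).+1; apply/negP => es.
  by have := leq_bigmax_seq (P := xpredT) (F := id) _ es isT; rewrite ltnn.
case: (ex_minnP big) => -[|p] ps pmin; first by rewrite s0 in ps.
have low e : (e <= p)%N -> e \in s.
  by move=> ep; apply: contraLR ep => /pmin; rewrite -ltnNge.
have high : exists e, (e \in s) && (p < e)%N.
  apply: contrapT => no; apply: ni; exists p => e.
  rewrite mem_iota add0n ltnS /=.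
  apply/idP/idP => [es|/low//]; rewrite leqNgt; apply/negP => pe.
  by apply: no; exists e; rewrite es.
case: (ex_minnP high) => q1 /andP[q1s pq1] q1min.
exists p, q1; split=> // [|e es pe]; last by apply: q1min; rewrite es.
by rewrite ltn_neqAle pq1 andbT; apply: contraNneq ps => ->.
Qed.

Lemma exists_shift (K : fieldType) n (G : {fset 'X_{1..n}}) (k : 'I_n) :
  antichain G -> (forall i, 0%N \in labels G i) ->
  ~ tight (row k (incidence_mx (monomial_gen K [set` G]))) ->
  exists p q1, [/\ shiftable (monomial_gen K [set` G]) k p q1,
    (p.+1 < q1)%N, q1 \in labels G k
    & {in labels G k, forall e, (p < e)%N -> (q1 <= e)%N}].
Proof.
move=> antiG G0 nt; have GE : mingens (monomial_gen K [set` G]) = G.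
  exact: mingensE.
have [|p [q1 [low ps q1s pq1 gap]]] := gap_of_not_interval (G0 k).
  move=> [l E]; apply: nt; exists l => e.
  by rewrite row_values_incidence GE mem_sort mem_undup E.
exists p, q1; split=> //.
have occ e : (exists2 v, v \in mingens (monomial_gen K [set` G]) & v k = e)
    <-> e \in labels G k.
  rewrite GE; split=> [[v vG <-]|/mapP[v vG ->]]; last by exists v.
  exact: labels_in.
split=> //.
- by move=> i; apply: incidence_zero; rewrite GE.
- by split=> [e /low/occ//|/occ]; exact/negP.
split; [exact/occ|exact: ltnW|by move=> e /occ es; exact: gap].
Qed.

Lemma signature_tight (K : fieldType) n (G : {fset 'X_{1..n}}) :
  antichain G ->
  (forall k, tight (row k (incidence_mx (monomial_gen K [set` G])))) ->
  signature (monomial_gen K [set` G]) = monomial_gen K [set` G].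
Proof.
move=> antiG tG; rewrite signatureE //; congr monomial_gen.
rewrite -[RHS]image_id; apply: eq_imagel => v vG; apply/mnmP => i; rewrite mnmE.
have [l E] := tG i; apply: (@rank_iota _ l); last exact: labels_in.
by move: E; rewrite row_values_incidence mingensE.
Qed.

Lemma mdeg_relabel n s (m : 'X_{1..n}) :
  (forall i e, (s i e <= e)%N) -> (mdeg (relabel s m) <= mdeg m)%N.
Proof. by move=> sle; rewrite !mdegE leq_sum // => i _; rewrite mnmE. Qed.

Definition total_degree (n : nat) (G : {fset 'X_{1..n}}) : nat :=
  (\sum_(v <- G) mdeg v)%N.

Lemma total_degree_relabel n s (G : {fset 'X_{1..n}}) (k : 'I_n) e :
  relabelling (labels G) s -> (forall i e, (s i e <= e)%N) ->
  e \in labels G k -> (s k e < e)%N ->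
  (total_degree [fset relabel s v | v in G]%fset < total_degree G)%N.
Proof.
move=> Gs sle ek lt; rewrite /total_degree.
have injs : {in G &, injective (relabel s)}.
  move=> u v uG vG E; have le :=
    relabel_mono Gs (fun i => labels_in i uG) (fun i => labels_in i vG).
  have ge :=
    relabel_mono Gs (fun i => labels_in i vG) (fun i => labels_in i uG).
  apply/mnmP => i; apply/eqP; rewrite eqn_leq.
  by rewrite !(mnm_lepP _ i) // -?le -?ge E lepm_refl.
rewrite big_imfset //=.
case/mapP: ek => v vG ev; rewrite !(big_rem v vG) /=.
rewrite -addSn leq_add //; last by apply: leq_sum => u _; exact: mdeg_relabel.
rewrite !mdegE [X in (_ < X)%N](bigD1 k) //= (bigD1 k) //= mnmE -addSn.
by rewrite leq_add -?ev // leq_sum // => i _; rewrite mnmE.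
Qed.

Lemma shift_steps_decomp (K : fieldType) n r (I J : set {mpoly K[n]})
    (q q' : 'I_r -> set {mpoly K[n]}) :
  shift_steps I q J q' -> irr_decomp J q'.
Proof. by elim. Qed.

(** The recursion stops because a shift lowers the total degree of the
    generators; it stops at the signature because shifts do not change the
    signature and an ideal with only tight rows is its own signature. *)
Lemma shift_to_signature (K : fieldType) n r (G : {fset 'X_{1..n}})
    (q : 'I_r -> set {mpoly K[n]}) :
  antichain G -> (forall i, 0%N \in labels G i) ->
  irr_decomp (monomial_gen K [set` G]) q ->
  exists2 q', shift_steps (monomial_gen K [set` G]) q
                (signature (monomial_gen K [set` G])) q' &
    forall j, radical (q j) = radical (q' j) /\ q j `<=` q' j.
Proof.
have [N] := ubnP (total_degree G); elim: N G q => // N IH G q lt antiG G0 dec.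
have [tG|nt] := pselect
  (forall k, tight (row k (incidence_mx (monomial_gen K [set` G])))).
  exists q => [|j]; last by split=> // f.
  by rewrite signature_tight //; exact: shift_done.
have [k ntk] :
    exists k, ~ tight (row k (incidence_mx (monomial_gen K [set` G]))).
  apply: contrapT => no; apply: nt => k; apply: contrapT => ntk; apply: no.
  by exists k.
have [p [q1 [sh ppq1 q1G gap]]] := exists_shift antiG G0 ntk.
have pq1 := ltnW ppq1.
have Gs := relabelling_shift G0 pq1 gap.
have [dec' step] := irr_decomp_shift G0 pq1 gap dec.
pose G' := [fset relabel (shift_label k p q1) v | v in G]%fset.
have G'E : monomial_gen K [set` G'] = shift (monomial_gen K [set` G]) k p q1.
  by rewrite shiftE // imfset_relabel.
have [q' steps qq'] : exists2 q',
    shift_steps (monomial_gen K [set` G'])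
      (fun j => shift_component (q j) k p q1)
      (signature (monomial_gen K [set` G'])) q' &
    forall j, radical (shift_component (q j) k p q1) = radical (q' j) /\
      shift_component (q j) k p q1 `<=` q' j.
  apply: IH.
  - apply: leq_trans (ltnSE lt).
    apply: (total_degree_relabel Gs _ q1G) => [i e|].
      exact: shift_label_le.
    by rewrite /shift_label eqxx leqnn /=; lia.
  - exact: antichain_relabel.
  - exact: zero_labels_relabel.
  by rewrite imfset_relabel.
exists q' => [|j].
  apply: shift_step sh _ => //.
  by rewrite -G'E -(signature_relabel K Gs antiG) -imfset_relabel.
have [r1 s1] := step j; have [r2 s2] := qq' j.
by split; [rewrite r1|exact: subset_trans s2].
Qed.

(** * Height and zero entries *)

Definition coord_ideal (K : fieldType) (n : nat) (k : 'I_n) :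
    set {mpoly K[n]} :=
  mono_ideal K [set m : 'X_{1..n} | (0 < m k)%N].
Arguments coord_ideal K {n} k.

Lemma coord_ideal_is_ideal (K : fieldType) n (k : 'I_n) :
  is_ideal (coord_ideal K k).
Proof.
apply: mono_ideal_is_ideal => m m' /mnm_lepP le m0; exact: leq_trans (le k).
Qed.

Lemma coord_ideal_factor (K : fieldType) n (k : 'I_n) (f : {mpoly K[n]}) :
  coord_ideal K k f -> exists h, f = h * 'X_k.
Proof.
move=> fk; exists (\sum_(m <- msupp f) f@_m *: 'X_[m - U_(k)]).
rewrite mulr_suml [LHS]mpolyE; apply: eq_big_seq => m /fk m0.
by rewrite -scalerAl -mpolyXD submK // -[U_(k)%MM]mulm1n pow_mnm_le.
Qed.

(** This yields primality: the kernel of a morphism into a domain is prime. *)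
Lemma coord_ideal_eval (K : fieldType) n (k : 'I_n) (f : {mpoly K[n]}) :
  coord_ideal K k f <-> f \mPo [tuple if i == k then 0 else 'X_i | i < n] = 0.
Proof.
set t := [tuple _ | _ < _].
have tX : 'X_k \mPo t = 0 by rewrite comp_mpolyXU -tnth_nth tnth_mktuple eqxx.
split=> [/coord_ideal_factor[h ->]|f0]; first by rewrite rmorphM /= tX mulr0.
have tm m : 'X_[m] \mPo t = if m k == 0%N then 'X_[m] else 0.
  rewrite comp_mpolyX; case: ifP => m0.
    rewrite [RHS](mpolyXE_id); apply: eq_bigr => i _; rewrite tnth_mktuple.
    by case: eqP => // ->; rewrite (eqP m0) !expr0.
  by rewrite (bigD1 k) //= tnth_mktuple eqxx expr0n m0 mul0r.
move=> m mf; rewrite /= lt0n; apply/negP => m0.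
move: mf; rewrite mcoeff_msupp => /eqP; apply.
suff <- : (f \mPo t)@_m = f@_m by rewrite f0 mcoeff0.
rewrite comp_mpolyEX raddf_sum [in RHS](mpolyE f) [in RHS]raddf_sum /=.
apply: eq_bigr => m' _; rewrite tm !mcoeffZ mcoeffX; congr (_ * _).
case: ifP => [_|m'k]; rewrite ?mcoeffX // mcoeff0.
by case: (m' =P m) => // E; rewrite E m0 in m'k.
Qed.

Lemma coord_ideal_prime (K : fieldType) n (k : 'I_n) :
  is_prime (coord_ideal K k).
Proof.
have [J0 JD] := coord_ideal_is_ideal K k.
split; [split|] => [|||u v]; rewrite ?inE //.
- apply/negP; rewrite inE => /(_ 0%MM).
  by rewrite msupp1 inE eqxx /= mnm0E => /(_ isT).
- by move=> a u v; rewrite !inE; exact: JD.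
move=> /coord_ideal_eval; rewrite rmorphM => /eqP; rewrite mulf_eq0.
by case/orP => /eqP/coord_ideal_eval uk; apply/orP; [left|right]; rewrite inE.
Qed.

Lemma prime_idealP (R : comNzRingType) (J : set R) :
  is_prime J -> is_ideal J /\ forall u v, J (u * v) -> J u \/ J v.
Proof.
case=> [[J0 _ JD] JM]; split; first split.
- by move: J0; rewrite inE.
- by move=> a u v Ju Jv; have := JD a u v; rewrite !inE; apply.
by move=> u v Juv; have := JM u v; rewrite !inE => /(_ Juv)/orP; rewrite !inE.
Qed.

(** A nonzero element of a smaller prime could be divided by [x_k] forever. *)
Lemma prime_below_coord (K : fieldType) n (k : 'I_n) (J : set {mpoly K[n]}) :
  is_prime J -> J `<` coord_ideal K k -> J `<=` [set 0].
Proof.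
move=> /prime_idealP[idJ JM] [Jk kJ] f Jf.
have nX : ~ J 'X_k.
  move=> JX; apply: kJ => g /coord_ideal_factor[h ->]; exact: ideal_mul.
have [d] := ubnP (msize f); elim: d f Jf => // d IH f Jf lt.
have [h E] := coord_ideal_factor (Jk f Jf).
have Jh : J h by move: Jf; rewrite E => /JM[].
have [h0|h0] := eqVneq h 0; first by rewrite E h0 mul0r.
rewrite E (IH h) ?mul0r // -ltnS (leq_trans _ lt) // ltnS E.
rewrite msizeM ?msizeX ?mdeg1 //; last first.
  by apply/eqP => X0; apply: nX; rewrite X0; case: idJ.
by rewrite addn2.
Qed.

(** If some row had no zero entry, the ideal would lie in the prime [(x_k)],
    which admits no chain of length two below it. *)
Lemma height2_zero_labels (K : fieldType) n (G : {fset 'X_{1..n}}) :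
  height_ge (monomial_gen K [set` G]) 2 -> forall k, 0%N \in labels G k.
Proof.
move=> ht k; apply: contrapT => /negP nk.
have sub : monomial_gen K [set` G] `<=` coord_ideal K k.
  apply: smallest_sub; first exact: coord_ideal_is_ideal.
  move=> _ [v vG <-]; apply/mono_idealX; rewrite /= lt0n.
  by apply: contraNneq nk => <-; exact: labels_in.
have [C [Cprime Clt C2]] := ht _ (coord_ideal_prime K k) sub.
have C1 : C 1%N `<=` [set 0].
  apply: (@prime_below_coord _ _ k); first exact: Cprime.
  by rewrite -C2; exact: Clt.
have [_] := Clt 0%N isT; apply=> f /C1 ->.
by have [[]] := prime_idealP (Cprime 0%N isT).
Qed.

Theorem theorem2p32 (K : fieldType) (n : nat) (I : set {mpoly K[n]})
    (r : nat) (q : 'I_r -> set {mpoly K[n]}) :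
  is_monomial_ideal I ->
  height_ge I 2 ->
  irr_decomp I q ->
  exists q' : 'I_r -> set {mpoly K[n]},
    [/\ forall j, [/\ irr_component (signature I) (q' j),
                      radical (q j) = radical (q' j)
                    & q j `<=` q' j],
        irr_decomp (signature I) q'
      & shift_steps I q (signature I) q'].
Proof.
move=> _ ht dec; have [P [S [a [_ IE _ /corner_decomp_gen[G antiG PE]]]]] :=
  irr_decomp_corner dec.
rewrite {P}PE -monomial_genE in IE; rewrite {I}IE in ht dec *.
have [q' steps qq'] := shift_to_signature antiG (height2_zero_labels ht) dec.
have dec' := shift_steps_decomp steps.
exists q'; split=> // j; have [rj sj] := qq' j; split=> //.
by exists r, q'; split=> //; exists j.
Qed.
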